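(* Let $\mathbf P=(P,\le,{}',0,1)$ be a Boolean poset. Then $\mathbf P$ satisfies both (1) $L\Big(U\big(L(x,y),y'\big),y\Big)\subseteq L(x)$ for all $x,y\in P$, and (2) $U\Big(L\big(U(x,y),y'\big),y\Big)\subseteq U(x)$ for all $x,y\in P$; and hence, if $\mathbf P$ satisfies the Ascending Chain Condition, the operators $\odot$ and $\to$ form an adjoint pair, i.e. for all $a,b,c\in P$, $a\odot b\le c$ if and only if $a\le b\to c$.
   Context: An orthoposet is a bounded poset $(P,\le,{}',0,1)$ with an antitone involution ${}'$ (i.e. $x\le y$ implies $y'\le x'$, and $x''=x$) that is a complementation (i.e. $x\vee x'=1$ and $x\wedge x'=0$ for all $x$). The Ascending Chain Condition (ACC) means that there is no infinite ascending chain (in orthoposets it is equivalent to the Descending Chain Condition). For $A\subseteq P$: $L(A):=\{x\in P\mid x\le y\text{ for all }y\in A\}$, $U(A):=\{x\in P\mid y\le x\text{ for all }y\in A\}$; $\operatorname{Max}A$ and $\operatorname{Min}A$ denote the sets of all maximal and all minimal elements of $A$. When several arguments (elements and/or subsets) are listed inside $L$ or $U$, the operator is applied to the union of these sets, elements being read as singletons; $LU(A):=L(U(A))$, $UL(A):=U(L(A))$. For $A,B\subseteq P$, $A\le B$ means $x\le y$ for all $x\in A$ and all $y\in B$, with elements identified with singletons. A poset is distributive if it satisfies one of the following equivalent identities (for all $x,y,z$): $L\big(U(x,y),z\big)=LU\big(L(x,z),L(y,z)\big)$; $UL\big(U(x,y),z\big)=U\big(L(x,z),L(y,z)\big)$;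 $U\big(L(x,y),z\big)=UL\big(U(x,z),U(y,z)\big)$; $LU\big(L(x,y),z\big)=L\big(U(x,z),U(y,z)\big)$. A Boolean poset is a distributive orthoposet. The binary operators $\odot$ and $\to$ (with values subsets of $P$) are defined, for $x,y\in P$, by $x\odot y:=\operatorname{Max}L\big(y,U(x,y')\big)$ and $x\to y:=\operatorname{Min}U\big(x',L(x,y)\big)$. *)

(* Defs.v *)
From mathcomp Require Import all_boot all_order.
From mathcomp Require Import boolp classical_sets.

Set Implicit Arguments.
Unset Strict Implicit.
Unset Printing Implicit Defensive.

Import Order.TTheory.
Local Open Scope classical_set_scope.
Local Open Scope order_scope.

Section Posets.
Context {d : Order.disp_t} {P : porderType d}.
Implicit Types (A B : set P) (x y z : P).

(* The operators L and U are [lbound] and [ubound]; several arguments inside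
   L or U are given as the union of the corresponding sets. *)

Definition max_elts A : set P :=
  [set x | A x /\ forall y, A y -> x <= y -> y = x].

Definition min_elts A : set P :=
  [set x | A x /\ forall y, A y -> y <= x -> y = x].

Definition set_le A B : Prop := forall x y, A x -> B y -> x <= y.

Definition ascending_chain_condition : Prop :=
  ~ exists u : nat -> P, forall n, u n < u n.+1.

(* The first of four equivalent identities, see [distributive_poset_tfae]. *)
Definition distributive_poset : Prop :=
  forall x y z,
    lbound (ubound [set x; y] `|` [set z]) =
    lbound (ubound (lbound [set x; z] `|` lbound [set y; z])).

End Posets.

Arguments ascending_chain_condition {d} P.
Arguments distributive_poset {d} P.

Section Orthoposets.
Context {d : Order.disp_t} {P : tbPOrderType d}.
Variable compl : P -> P.

(* [P] need not have binary joins and meets: [supremums A \top] says that the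
   join of [A] exists and equals [\top], and dually for [infimums A \bot]. *)
Record orthoposet : Prop := Orthoposet {
  compl_antitone : forall x y : P, x <= y -> compl y <= compl x;
  compl_involutive : involutive compl;
  compl_join : forall x : P, supremums [set x; compl x] \top;
  compl_meet : forall x : P, infimums [set x; compl x] \bot
}.

Definition boolean_poset : Prop := orthoposet /\ distributive_poset P.

Definition odot (x y : P) : set P :=
  max_elts (lbound ([set y] `|` ubound [set x; compl y])).

Definition imp (x y : P) : set P :=
  min_elts (ubound ([set compl x] `|` lbound [set x; y])).

End Orthoposets.

Section DistributiveTFAE.
Context {d : Order.disp_t} (P : porderType d).

Let lb2 (x y w : P) : lbound [set x; y] w <-> w <= x /\ w <= y.
Proof.
split=> [h|[hx hy] v [->|->]//].
by split; apply: h; [left | right].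
Qed.

Let ub2 (x y w : P) : ubound [set x; y] w <-> x <= w /\ y <= w.
Proof.
split=> [h|[hx hy] v [->|->]//].
by split; apply: h; [left | right].
Qed.

Let lub_sub (A B : set P) : A `<=` B -> ubound B `<=` ubound A.
Proof. by move=> AB x Bx y /AB; apply: Bx. Qed.

Let glb_sub (A B : set P) : A `<=` B -> lbound B `<=` lbound A.
Proof. by move=> AB x Bx y /AB; apply: Bx. Qed.

Let ULU (A : set P) : ubound (lbound (ubound A)) = ubound A.
Proof.
apply/seteqP; split=> x; first by move=> h y Ay; apply: h => z; apply.
by move=> Ax y; apply.
Qed.

Let LUL (A : set P) : lbound (ubound (lbound A)) = lbound A.
Proof.
apply/seteqP; split=> x; first by move=> h y Ay; apply: h => z; apply.
by move=> Ax y; apply.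
Qed.

Lemma distributive_poset_tfae :
  [<-> distributive_poset P;
       forall x y z : P,
         ubound (lbound (ubound [set x; y] `|` [set z])) =
         ubound (lbound [set x; z] `|` lbound [set y; z]);
       forall x y z : P,
         ubound (lbound [set x; y] `|` [set z]) =
         ubound (lbound (ubound [set x; z] `|` ubound [set y; z]));
       forall x y z : P,
         lbound (ubound (lbound [set x; y] `|` [set z])) =
         lbound (ubound [set x; z] `|` ubound [set y; z])].
Proof.
tfae.
- by move=> D x y z; rewrite D ULU.
- move=> D x y z.
  have D' (p q a u : P) : ubound [set p; q] `<=` [set v | a <= v] ->
      (forall b, b <= p -> b <= a -> b <= u) ->
      (forall b, b <= q -> b <= a -> b <= u) -> a <= u.
    move=> pqa pu qu.
    have : ubound (lbound [set p; a] `|` lbound [set q; a]) u.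
      by move=> b [] /lb2[b1 b2]; [apply: pu | apply: qu].
    by rewrite -D; apply=> v [/pqa//|->].
  apply/seteqP; split=> u; last first.
    move=> h v [/lb2[vx vy]|->]; apply: h => w [] /ub2[w1 w2] //.
      exact: le_trans w1.
    exact: le_trans w1.
  move=> h a ha; have zu : z <= u by apply: h; right.
  apply: (D' x z a) => [v xzv|b bx ba|b bz _]; last exact: le_trans zu.
    by apply: ha; left.
  apply: (D' y z b) => [v yzv|c cy cb|c cz _]; last exact: le_trans zu.
    by apply: le_trans ba _; apply: ha; right.
  by apply: h; left; apply/lb2; split=> //; apply: le_trans bx.
- by move=> D x y z; rewrite D LUL.
- move=> D x y z.
  have D' (p q a u : P) : lbound [set p; q] `<=` [set v | v <= a] ->
      (forall b, p <= b -> a <= b -> u <= b) ->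
      (forall b, q <= b -> a <= b -> u <= b) -> u <= a.
    move=> pqa pu qu.
    have : lbound (ubound [set p; a] `|` ubound [set q; a]) u.
      by move=> b [] /ub2[b1 b2]; [apply: pu | apply: qu].
    by rewrite -D; apply=> v [/pqa//|->].
  apply/seteqP; split=> u; last first.
    move=> h v [/ub2[vx vy]|->]; apply: h => w [] /lb2[w1 w2] //.
      exact: le_trans vx.
    exact: le_trans vy.
  move=> h a ha; have uz : u <= z by apply: h; right.
  apply: (D' x z a) => [v xzv|b xb ab|b zb _]; last exact: le_trans zb.
    by apply: ha; left.
  apply: (D' y z b) => [v yzv|c yc bc|c zc _]; last exact: le_trans zc.
    by apply: le_trans ab; apply: ha; right.
  by apply: h; left; apply/ub2; split=> //; apply: le_trans bc.
Qed.

End DistributiveTFAE.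

(* Main.v *)
Require Import Defs.
From mathcomp Require Import all_boot all_order.
From mathcomp Require Import boolp classical_sets.
Import Order.TTheory.
Local Open Scope classical_set_scope.
Local Open Scope order_scope.

(** In a Boolean poset, distributivity and complementation give the
    cancellation laws [L(U(x,y'),y) = L(x,y)] and [U(L(x,y'),y) = U(x,y)]:
    distributing [y] over [x] and [y'] leaves the terms [x, y] and [y', y], and
    the latter contributes nothing, since [0] is the only common lower bound of
    [y'] and [y], and [1] their only common upper bound ([lbound_join_compl],
    [ubound_meet_compl]).  The second law at [y'] reads
    [U(L(x,y),y') = U(x,y')]; applying the first law to the result gives
    [L(U(L(x,y),y'),y) = L(x,y)], which is contained in [L(x)]; the second
    inclusion is dual.

    The same laws turn [x \odot y] into [Max L(x,y)] and [x \to y] into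
    [Min U(y,x')].  Under ACC every element of a set lies below a maximal one,
    and the antitone involution transports this to minimal elements.  Hence
    [a \odot b <= c] says that [c] bounds [L(a,b)] from above, and
    [a <= b \to c] says that [a] bounds [U(c,b')] from below.  These two
    conditions are equivalent by one more use of each cancellation law
    ([boolean_residuation]). *)

Section Bounds.
Context {d : Order.disp_t} {P : porderType d}.
Implicit Types (A : set P) (x y w : P).

Lemma lbound2P x y w : lbound [set x; y] w <-> w <= x /\ w <= y.
Proof.
split=> [h|[hx hy] v [->|->]//].
by split; apply: h; [left | right].
Qed.

Lemma ubound2P x y w : ubound [set x; y] w <-> x <= w /\ y <= w.
Proof.
split=> [h|[hx hy] v [->|->]//].
by split; apply: h; [left | right].
Qed.

(** A set without maximal elements above [x] would have a strict successor
    function there, whose orbit from [x] is an infinite ascending chain. *)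
Lemma acc_max_elts A x : ascending_chain_condition P -> A x ->
  exists2 m, max_elts A m & x <= m.
Proof.
move=> acc Ax; apply: contrapT => nomax; apply: acc.
have succ_ex y : exists z, A y /\ x <= y -> [/\ A z, x <= z & y < z].
  have [[Ay xy]|nAy] := pselect (A y /\ x <= y); last by exists y.
  apply: contrapT => noz; apply: nomax; exists y => //; split=> // z Az yz.
  apply: contrapT => /eqP zy; apply: noz; exists z => _.
  by split=> //; [exact: le_trans yz | rewrite lt_neqAle eq_sym zy].
have [f fP] := choice succ_ex.
have uP n : A (iter n f x) /\ x <= iter n f x.
  by elim: n => [//|n /fP[]].
by exists (fun n => iter n f x) => n; have [] := fP _ (uP n).
Qed.

Lemma acc_set_le_max A c : ascending_chain_condition P ->
  set_le (max_elts A) [set c] <-> ubound A c.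
Proof.
move=> acc; split=> [h x /(acc_max_elts _ _ acc)[m mA xm]|h x _ [Ax _] ->].
  by apply: le_trans xm _; apply: h.
exact: h.
Qed.

End Bounds.

Section BooleanPosets.
Context {d : Order.disp_t} {P : tbPOrderType d}.
Variable compl : P -> P.
Implicit Types (A : set P) (a b c x y z : P).

Lemma acc_min_elts A x : orthoposet compl -> ascending_chain_condition P ->
  A x -> exists2 m, min_elts A m & m <= x.
Proof.
move=> [anti invol _ _] acc Ax.
have [|m [Am mmax] xm] := acc_max_elts (compl @^-1` A) (compl x) acc.
  by rewrite /= invol.
exists (compl m); last by rewrite -[x]invol; apply: anti.
split=> // y Ay ym; rewrite -(mmax (compl y)) ?invol //=.
  by rewrite invol.
by rewrite -[m]invol; apply: anti.
Qed.

Lemma acc_set_le_min A a : orthoposet compl -> ascending_chain_condition P ->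
  set_le [set a] (min_elts A) <-> lbound A a.
Proof.
move=> ortho acc; split=> [h x /(acc_min_elts _ _ ortho acc)[m mA mx]|h _ x -> [Ax _]].
  by apply: le_trans mx; apply: h.
exact: h.
Qed.

Lemma lbound_compl y z : orthoposet compl ->
  lbound [set compl y; y] z -> z = \bot.
Proof.
move=> ortho /lbound2P[zy' zy]; apply/eqP; rewrite -lex0.
by have [_] := compl_meet ortho y; apply; apply/lbound2P.
Qed.

Lemma ubound_compl y z : orthoposet compl ->
  ubound [set compl y; y] z -> z = \top.
Proof.
move=> ortho /ubound2P[zy' zy]; apply/eqP; rewrite -le1x.
by have [_] := compl_join ortho y; apply; apply/ubound2P.
Qed.

Hypothesis boolean : boolean_poset compl.

(** The poset form of [(x \/ y') /\ y = x /\ y]. *)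
Lemma lbound_join_compl x y :
  lbound (ubound [set x; compl y] `|` [set y]) = lbound [set x; y].
Proof.
have [ortho distr] := boolean; rewrite distr; apply/seteqP; split=> w h.
  apply/lbound2P; split; apply: h => v [/lbound2P[]//|/(lbound_compl _ _ ortho) ->];
    exact: le0x.
by move=> v; apply; left.
Qed.

(** The poset form of [(x /\ y') \/ y = x \/ y]. *)
Lemma ubound_meet_compl x y :
  ubound (lbound [set x; compl y] `|` [set y]) = ubound [set x; y].
Proof.
have [ortho /(distributive_poset_tfae P 0%N 2%N) /= distr] := boolean.
rewrite distr.
apply/seteqP; split=> w h.
  apply/ubound2P; split; apply: h => v [/ubound2P[]//|/(ubound_compl _ _ ortho) ->];
    exact: lex1.
by move=> v; apply; left.
Qed.

Lemma lbound_join_complC x y :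
  lbound (ubound [set x; y] `|` [set compl y]) = lbound [set x; compl y].
Proof.
by have [[_ invol _ _] _] := boolean; rewrite -{1}[y]invol lbound_join_compl.
Qed.

Lemma ubound_meet_complC x y :
  ubound (lbound [set x; y] `|` [set compl y]) = ubound [set x; compl y].
Proof.
by have [[_ invol _ _] _] := boolean; rewrite -{1}[y]invol ubound_meet_compl.
Qed.

Lemma odotE x y : odot compl x y = max_elts (lbound [set x; y]).
Proof. by rewrite /odot setUC lbound_join_compl. Qed.

Lemma impE x y : imp compl x y = min_elts (ubound [set y; compl x]).
Proof. by rewrite /imp setUC [[set x; y]]setUC ubound_meet_complC. Qed.

(** The poset form of [a /\ b <= c <-> a <= c \/ b'].  For one
    direction, an upper bound of [c] and [b'] is one of [L(a,b)] and [b'], hence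
    of [a]; for the other, a lower bound of [a] and [b] is one of [U(c,b')] and
    [b], hence of [c]. *)
Lemma boolean_residuation a b c :
  ubound (lbound [set a; b]) c <-> lbound (ubound [set c; compl b]) a.
Proof.
split=> h v.
  move=> /ubound2P[cv b'v].
  suff /ubound2P[] : ubound [set a; compl b] v by [].
  rewrite -ubound_meet_complC => w [/h wc|->//].
  exact: le_trans wc cv.
move=> /lbound2P[va vb].
suff /lbound2P[] : lbound [set c; b] v by [].
rewrite -lbound_join_compl => w [/h aw|->//].
exact: le_trans va aw.
Qed.

End BooleanPosets.

Theorem corollary5p2 (d : Order.disp_t) (P : tbPOrderType d) (compl : P -> P)
    (hP : boolean_poset compl) :
  ((forall x y : P,
      lbound (ubound (lbound [set x; y] `|` [set compl y]) `|` [set y])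
        `<=` lbound [set x]) /\
   (forall x y : P,
      ubound (lbound (ubound [set x; y] `|` [set compl y]) `|` [set y])
        `<=` ubound [set x])) /\
  (ascending_chain_condition P ->
   forall a b c : P,
     set_le (odot compl a b) [set c] <-> set_le [set a] (imp compl b c)).
Proof.
split; first split=> x y w.
- rewrite ubound_meet_complC // lbound_join_compl // => h v xv.
  by apply: h; left.
- rewrite lbound_join_complC // ubound_meet_compl // => h v xv.
  by apply: h; left.
move=> acc a b c; have [ortho _] := hP.
rewrite odotE // impE // acc_set_le_max // (acc_set_le_min _ _ _ ortho) //.
exact: boolean_residuation.
Qed.
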